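(* Let $\mathbb{K}$ be a field and let $T=\sum_{i=1}^r u_i \otimes v_i \otimes w_i$ be a tensor in $\mathbb{K}^{m \times n \times p}$, where $u_i\in\mathbb{K}^m$, $v_i\in\mathbb{K}^n$, $w_i\in\mathbb{K}^p$, such that: (i) the vectors $u_1,\dots,u_r$ are linearly independent; (ii) the vectors $v_1,\dots,v_r$ are linearly independent; (iii) every vector $w_i$ is nonzero. Then $\operatorname{rank}(T)=r$, and $T$ has a unique matrix-vector decomposition of rank $r$.
   Context: For $u\in\mathbb{K}^m,v\in\mathbb{K}^n,w\in\mathbb{K}^p$, $u\otimes v\otimes w$ is the tensor with entries $u_iv_jw_k$; the rank of a tensor $T$ is the least number of nonzero such tensors summing to $T$. For a matrix $M\in M_{m,n}(\mathbb{K})$ and $w\in\mathbb{K}^p$, $M\otimes w$ is the tensor with entries $M_{ij}w_k$. A matrix-vector decomposition of $T$ is an expression $T=\sum_{\ell=1}^q M_\ell\otimes w_\ell$ with all $M_\ell\in M_{m,n}(\mathbb{K})$ nonzero, all $w_\ell\in\mathbb{K}^p$ nonzero, and no two of the vectors $w_\ell$ colinear; its rank is $\sum_{\ell}\operatorname{rank}(M_\ell)$. ''Unique matrix-vector decomposition of rank $r$'' means that, up to permutation, the terms $M_\ell\otimes w_\ell$ are the same in all matrix-vector decompositions of $T$ of rank $r$. *)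

(* Defs.v *)
From HB Require Import structures.
From mathcomp Require Import all_boot all_order all_algebra.
Set Implicit Arguments.
Unset Strict Implicit.
Unset Printing Implicit Defensive.
Import GRing.Theory.
Local Open Scope ring_scope.

Notation tensor K m n p := {ffun 'I_m * 'I_n * 'I_p -> K}.

Definition pure_tensor (K : fieldType) (m n p : nat)
    (u : 'rV[K]_m) (v : 'rV[K]_n) (w : 'rV[K]_p) : tensor K m n p :=
  [ffun x => u 0 x.1.1 * v 0 x.1.2 * w 0 x.2].

Definition mxvec_tensor (K : fieldType) (m n p : nat)
    (M : 'M[K]_(m, n)) (w : 'rV[K]_p) : tensor K m n p :=
  [ffun x => M x.1.1 x.1.2 * w 0 x.2].

Definition sum_of_pure (K : fieldType) (m n p : nat)
    (T : tensor K m n p) (q : nat) : Prop :=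
  exists (u : 'I_q -> 'rV[K]_m) (v : 'I_q -> 'rV[K]_n) (w : 'I_q -> 'rV[K]_p),
    (forall i, pure_tensor (u i) (v i) (w i) != 0) /\
    T = \sum_(i < q) pure_tensor (u i) (v i) (w i).

(* The rank is a relation rather than a function: over an arbitrary field the
   minimum cannot be computed. *)
Definition has_tensor_rank (K : fieldType) (m n p : nat)
    (T : tensor K m n p) (r : nat) : Prop :=
  sum_of_pure T r /\ forall q, sum_of_pure T q -> (r <= q)%N.

Definition colinear (K : fieldType) (p : nat) (x y : 'rV[K]_p) : bool :=
  (x \in <[y]>%VS) || (y \in <[x]>%VS).

Definition mv_terms (K : fieldType) (m n p : nat)
    (s : seq ('M[K]_(m, n) * 'rV[K]_p)) : seq (tensor K m n p) :=
  [seq mxvec_tensor d.1 d.2 | d <- s].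

(* [pairwise] compares the entries at distinct positions of the list, so a
   repeated vector is excluded. *)
Definition mv_decomposition (K : fieldType) (m n p : nat)
    (T : tensor K m n p) (s : seq ('M[K]_(m, n) * 'rV[K]_p)) : Prop :=
  [/\ all (fun d => d.1 != 0) s,
      all (fun d => d.2 != 0) s,
      pairwise (fun x y => ~~ colinear x y) [seq d.2 | d <- s]
    & T = \sum_(t <- mv_terms s) t].

Definition mv_rank (K : fieldType) (m n p : nat)
    (s : seq ('M[K]_(m, n) * 'rV[K]_p)) : nat :=
  (\sum_(d <- s) \rank d.1)%N.

(* Uniqueness concerns the terms, not the pairs (M, w): each pair can be
   rescaled to (a *: M, a^-1 *: w) without changing its term. *)
Definition unique_mv_decomposition (K : fieldType) (m n p : nat)
    (T : tensor K m n p) (r : nat) : Prop :=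
  (exists s, mv_decomposition T s /\ mv_rank s = r) /\
  (forall s1 s2,
     mv_decomposition T s1 -> mv_rank s1 = r ->
     mv_decomposition T s2 -> mv_rank s2 = r ->
     perm_eq (mv_terms s1) (mv_terms s2)).

(* Main.v *)
(** The slices of [T] along the third mode are [T_k = \sum_j w_j(k) v_j^T u_j]
    (transposed), so a dual family [x_j] of the [v_j] gives
    [x_j T_k = w_j(k) u_j].  In a matrix-vector decomposition [(M_l, z_l)] of
    [T] the row spaces of the [M_l^T] therefore contain every [u_j], hence the
    rank is at least [r].  When it equals [r], these row spaces are in direct
    sum; projecting [x_j T_k] on the [l]-th one gives
    [w_j(k) y_lj = z_l(k) x_j M_l^T], where [y_lj] is the projection of [u_j].
    So [y_lj = 0] unless [w_j] and [z_l] span the same line, and since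
    [\sum_l y_lj = u_j] we get [y_lj = u_j] in the latter case.  Projecting [T]
    itself, [M_l (x) z_l] is the sum of the terms [u_j (x) v_j (x) w_j] with
    [w_j] colinear to [z_l]. *)
Require Import Defs.
From HB Require Import structures.
From mathcomp Require Import all_boot all_order all_algebra.
Set Implicit Arguments.
Unset Strict Implicit.
Unset Printing Implicit Defensive.
Import GRing.Theory.
Local Open Scope ring_scope.

(** * Freeness, lines and rank-one matrices *)

Lemma free_row_free (K : fieldType) (r n : nat) (v : r.-tuple 'rV[K]_n) :
  free v -> row_free (\matrix_j tnth v j).
Proof.
move=> /freeP free_v; rewrite -kermx_eq0; apply/rowV0P => x.
move=> /sub_kermxP; rewrite mulmx_sum_row => xv0.
apply/rowP => j; rewrite mxE; apply: free_v j; rewrite -[RHS]xv0.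
by apply: eq_bigr => j _; rewrite rowK (tnth_nth 0).
Qed.

Lemma eq_vline (K : fieldType) (vT : vectType K) (x y : vT) :
  x != 0 -> x \in <[y]>%VS -> (<[x]> == <[y]>)%VS.
Proof.
by move=> x0 xy; rewrite eqEdim -memvE xy !dim_vline x0 leq_b1.
Qed.

Lemma colinearE (K : fieldType) (p : nat) (x y : 'rV[K]_p) :
  x != 0 -> y != 0 -> colinear x y = (<[x]> == <[y]>)%VS.
Proof.
move=> x0 y0; apply/orP/idP => [[/(eq_vline x0) //|]|/eqP <-].
  by move=> /(eq_vline y0); rewrite eq_sym.
by left; rewrite memv_line.
Qed.

Lemma mxrank_outer_le1 (K : fieldType) (m n : nat)
    (u : 'rV[K]_m) (v : 'rV[K]_n) : (\rank (u^T *m v) <= 1)%N.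
Proof. exact: leq_trans (mxrankM_maxr _ _) (rank_leq_row _). Qed.

(** * Slices of a tensor along the third mode *)

Section Slices.
Variables (K : fieldType) (m n p : nat).
Implicit Type T : tensor K m n p.

(** Transposed, so that row vectors of K^n act on the left and the row space lies in K^m, with the
    [u j]. *)
Definition slice (k : 'I_p) T : 'M[K]_(n, m) := \matrix_(j, i) T (i, j, k).

Lemma slice_sum (I : Type) (s : seq I) (P : pred I) (F : I -> tensor K m n p)
    (k : 'I_p) :
  slice k (\sum_(i <- s | P i) F i) = \sum_(i <- s | P i) slice k (F i).
Proof.
by apply: (big_morph (slice k)) => [T1 T2|]; apply/matrixP=> j i; rewrite !mxE ffunE.
Qed.

Lemma slice_inj T1 T2 : (forall k, slice k T1 = slice k T2) -> T1 = T2.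
Proof.
move=> eqT; apply/ffunP => -[[i j] k].
by have /matrixP/(_ j i) := eqT k; rewrite !mxE.
Qed.

Lemma slice_mxvec (M : 'M[K]_(m, n)) (z : 'rV[K]_p) (k : 'I_p) :
  slice k (mxvec_tensor M z) = z 0 k *: M^T.
Proof. by apply/matrixP => j i; rewrite !mxE ffunE mulrC. Qed.

Lemma pure_tensorE (u : 'rV[K]_m) (v : 'rV[K]_n) (z : 'rV[K]_p) :
  pure_tensor u v z = mxvec_tensor (u^T *m v) z.
Proof. by apply/ffunP => x; rewrite !ffunE !mxE big_ord1 !mxE. Qed.

Lemma slice_pure (u : 'rV[K]_m) (v : 'rV[K]_n) (z : 'rV[K]_p) (k : 'I_p) :
  slice k (pure_tensor u v z) = z 0 k *: (v^T *m u).
Proof. by rewrite pure_tensorE slice_mxvec trmx_mul trmxK. Qed.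

Lemma pure_tensor_neq0 (u : 'rV[K]_m) (v : 'rV[K]_n) (z : 'rV[K]_p) :
  u != 0 -> v != 0 -> z != 0 -> pure_tensor u v z != 0.
Proof.
move=> /rV0Pn[i ui] /rV0Pn[j vj] /rV0Pn[k zk]; apply/eqP => /ffunP/(_ (i, j, k)).
by rewrite !ffunE /= => /eqP; rewrite !mulf_eq0 (negPf ui) (negPf vj) (negPf zk).
Qed.

End Slices.

(** * The tensor [T] and the vectors dual to the [v j] *)

Section Decompositions.
Variables (K : fieldType) (m n p r : nat).
Variables (u : 'I_r -> 'rV[K]_m) (v : 'I_r -> 'rV[K]_n) (w : 'I_r -> 'rV[K]_p).
Hypotheses (free_u : row_free (\matrix_i u i)) (free_v : row_free (\matrix_i v i)).
Hypothesis w_neq0 : forall i, w i != 0.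

Let T := \sum_i pure_tensor (u i) (v i) (w i).

(** The matrix with rows [v i] has a right inverse; its columns are the dual vectors. *)
Lemma dual_family :
  exists x : 'I_r -> 'rV[K]_n, forall i j, x i *m (v j)^T = (i == j)%:R%:M.
Proof.
have /row_freeP[X vX] := free_v; exists (fun i => row i X^T) => i j.
have -> : v j = row j (\matrix_i v i) by rewrite rowK.
rewrite -tr_col -trmx_mul colE -row_mul mulmxA vX mul1mx.
by apply/matrixP => a b; rewrite !ord1 !mxE eqxx andbT eq_sym mulr1n.
Qed.

Lemma row_free_neq0 (q : nat) (y : 'I_r -> 'rV[K]_q) j :
  row_free (\matrix_i y i) -> y j != 0.
Proof.
move=> free_y; apply/eqP => y0.
have /eqP : (delta_mx 0 j : 'rV[K]_r) *m \matrix_i y i = 0 *m \matrix_i y i.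
  by rewrite -rowE rowK mul0mx.
rewrite (inj_eq (row_free_inj free_y)) => /eqP/matrixP/(_ 0 j)/eqP.
by rewrite !mxE !eqxx oner_eq0.
Qed.

Lemma mul_dual_slice (x : 'I_r -> 'rV[K]_n) :
    (forall i j, x i *m (v j)^T = (i == j)%:R%:M) ->
  forall j k, x j *m slice k T = w j 0 k *: u j.
Proof.
move=> xv j k; rewrite slice_sum mulmx_sumr (bigD1 j) //= big1 => [|i ij].
  by rewrite slice_pure -scalemxAr mulmxA xv eqxx mul1mx addr0.
by rewrite slice_pure -scalemxAr mulmxA xv eq_sym (negPf ij) raddf0 mul0mx scaler0.
Qed.

(** * Expressions of [T] as a sum of matrix-vector terms *)

Section Family.
Variables (I : finType) (M : I -> 'M[K]_(m, n)) (z : I -> 'rV[K]_p).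
Hypothesis T_Mz : T = \sum_l mxvec_tensor (M l) (z l).

Lemma slice_Mz k : slice k T = \sum_l z l 0 k *: (M l)^T.
Proof. by rewrite T_Mz slice_sum; apply: eq_bigr => l _; rewrite slice_mxvec. Qed.

Lemma sub_row_spaces : (\matrix_i u i <= \sum_l <<(M l)^T>>)%MS.
Proof.
have [x xv] := dual_family; apply/row_subP => j; rewrite rowK.
have /rV0Pn[k wk] := w_neq0 j.
rewrite -[u j](scalerK wk) -(mul_dual_slice xv) slice_Mz mulmx_sumr.
rewrite scalemx_sub // summx_sub // => l _.
by rewrite -scalemxAr scalemx_sub // (sumsmx_sup l) // genmxE submxMl.
Qed.

(** The independent [u i] lie in a sum of row spaces, whose dimension is at most the sum of the
    ranks. This bounds the tensor rank as well, through matrices of rank one. *)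
Lemma rank_lower_bound : (r <= \sum_l \rank (M l))%N.
Proof.
rewrite -{1}(eqP free_u) (leq_trans (mxrankS sub_row_spaces)) //.
apply: (big_ind2 (fun (A : 'M[K]_m) q => \rank A <= q)%N) => [|A a B b Aa Bb|l _].
- by rewrite mxrank0.
- exact: leq_trans (mxrank_adds_leqif A B) (leq_add Aa Bb).
- by rewrite mxrank_gen mxrank_tr.
Qed.

Hypothesis rank_M : (\sum_l \rank (M l) = r)%N.

(** The sum has dimension at least [r], which is now the sum of the dimensions. *)
Lemma mxdirect_row_spaces : mxdirect (\sum_l <<(M l)^T>>).
Proof.
rewrite mxdirectEgeq /=.
under eq_bigr do rewrite mxrank_gen mxrank_tr.
by rewrite rank_M -{1}(eqP free_u) mxrankS // sub_row_spaces.
Qed.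

Hypothesis M_neq0 : forall l, M l != 0.
Hypothesis z_neq0 : forall l, z l != 0.
Hypothesis z_lines : forall l l', (<[z l]> == <[z l']>)%VS -> l = l'.

Let pr l := proj_mx <<(M l)^T>>%MS (\sum_(l' | l' != l) <<(M l')^T>>)%MS.

Lemma proj_row_space l l' : (M l')^T *m pr l = if l' == l then (M l')^T else 0.
Proof.
have /mxdirect_sumsP/(_ l isT) direct_l := mxdirect_row_spaces.
case: eqVneq => [->|l'l]; first by rewrite proj_mx_id // genmxE.
by rewrite proj_mx_0 // (sumsmx_sup l') // genmxE.
Qed.

Lemma slice_proj l k : slice k T *m pr l = z l 0 k *: (M l)^T.
Proof.
rewrite slice_Mz mulmx_suml (bigD1 l) //= big1 => [|l' l'l].
  by rewrite -scalemxAl proj_row_space eqxx addr0.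
by rewrite -scalemxAl proj_row_space (negPf l'l) scaler0.
Qed.

Lemma proj_u_eq0 l j : (<[w j]> != <[z l]>)%VS -> u j *m pr l = 0.
Proof.
have [x xv] := dual_family => wz.
have eq_k k : w j 0 k *: (u j *m pr l) = z l 0 k *: (x j *m (M l)^T).
  by rewrite scalemxAl -(mul_dual_slice xv) -mulmxA slice_proj scalemxAr.
move: (u j *m pr l) (x j *m (M l)^T) eq_k => y q eq_k.
apply: contraNeq wz => /rV0Pn[a ya]; apply: eq_vline => //.
(* At the coordinate [a], w_j(k) y_a = z_l(k) q_a for every k; dividing by y_a writes [w j] as a
   multiple of [z l]. *)
apply/vlineP; exists (q 0 a / y 0 a).
apply/rowP => k; have /rowP/(_ a) := eq_k k; rewrite !mxE => eq_a.
by rewrite mulrAC [_ * z l 0 k]mulrC -eq_a mulrK ?unitfE.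
Qed.

(** In x_j T_k = w_j(k) u_j, the l-th term of the decomposition contributes w_j(k) times the l-th
    projection of u_j; a nonzero w_j(k) cancels. *)
Lemma sum_proj_u j : \sum_l u j *m pr l = u j.
Proof.
have [x xv] := dual_family; have /rV0Pn[k wk] := w_neq0 j.
apply: (scalerI wk); rewrite -(mul_dual_slice xv j k) slice_Mz scaler_sumr mulmx_sumr.
apply: eq_bigr => l _.
by rewrite scalemxAl -(mul_dual_slice xv) -mulmxA slice_proj.
Qed.

Lemma proj_u_id l j : (<[w j]> == <[z l]>)%VS -> u j *m pr l = u j.
Proof.
move=> /eqP wz; rewrite -[RHS]sum_proj_u (bigD1 l) //= big1 ?addr0 // => l' l'l.
by apply: proj_u_eq0; rewrite wz; apply: contraNN l'l => /z_lines ->.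
Qed.

(** Otherwise all projections of [u j] vanish, hence so does their sum [u j]. *)
Lemma line_hit j : exists l, (<[w j]> == <[z l]>)%VS.
Proof.
apply/existsP; have := row_free_neq0 j free_u; apply: contraNT => /existsPn no_l.
by rewrite -(sum_proj_u j) big1 // => l _; apply: proj_u_eq0.
Qed.

Lemma mv_term_eq l :
  mxvec_tensor (M l) (z l) =
  \sum_(j | (<[w j]> == <[z l]>)%VS) pure_tensor (u j) (v j) (w j).
Proof.
apply: slice_inj => k; rewrite slice_mxvec -slice_proj !slice_sum mulmx_suml.
rewrite (bigID (fun j => (<[w j]> == <[z l]>)%VS)) /= [X in _ + X]big1 => [|j wz].
  rewrite addr0; apply: eq_bigr => j wz.
  by rewrite slice_pure -scalemxAl -mulmxA proj_u_id.
by rewrite slice_pure -scalemxAl -mulmxA proj_u_eq0 ?mulmx0 ?scaler0.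
Qed.

(** Otherwise the sum in [mv_term_eq] is empty, while [M l] and [z l] are nonzero. *)
Lemma mv_line_hit l : exists j, (<[w j]> == <[z l]>)%VS.
Proof.
apply/existsP; have := M_neq0 l; apply: contraNT => /existsPn no_j.
have /rV0Pn[k zk] := z_neq0 l.
have /(congr1 (slice k)) := mv_term_eq l.
rewrite big_pred0 => [|j]; last exact/negbTE/no_j.
rewrite slice_mxvec => /matrixP M0; apply/eqP/matrixP => a b; have := M0 b a.
by rewrite !mxE ffunE => /eqP; rewrite mulf_eq0 (negPf zk) => /eqP.
Qed.

End Family.

(** * Colinearity classes: uniqueness and existence *)

Definition line_class (z : 'rV[K]_p) : {set 'I_r} := [set j | (<[w j]> == <[z]>)%VS].

Definition class_tensor (C : {set 'I_r}) : tensor K m n p :=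
  \sum_(j in C) pure_tensor (u j) (v j) (w j).

(** The list after [undup] depends only on [w], so two decompositions of rank [r] have the same
    terms up to order. *)
Lemma decomposition_classes (s : seq ('M[K]_(m, n) * 'rV[K]_p)) :
    mv_decomposition T s -> mv_rank s = r ->
  mv_terms s = map class_tensor [seq line_class d.2 | d <- s] /\
  perm_eq [seq line_class d.2 | d <- s] (undup [seq line_class (w j) | j <- enum 'I_r]).
Proof.
move=> [/allP M0 /allP z0 z_pair]; rewrite /mv_terms /mv_rank big_map !(big_tnth _ _ s).
set d := tnth _ => T_d rank_d.
have s_d x : x \in s -> exists l, x = d l by move/(tnthP (in_tuple s)).
have Md0 l : (d l).1 != 0 by exact/M0/mem_tnth.
have zd0 l : (d l).2 != 0 by exact/z0/mem_tnth.
have d_lines l l' : (<[(d l).2]> == <[(d l').2]>)%VS -> l = l'.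
  (* [pairwise] compares a position with later ones only; the other order follows by symmetry. [d l]
     is a mere default for [nth]. *)
  move=> ll'; move: z_pair; rewrite pairwise_map => /(pairwiseP (d l)) z_pair.
  have no_lt (a b : 'I_(size s)) : (a < b)%N -> (<[(d a).2]> == <[(d b).2]>)%VS -> False.
    move=> /(z_pair _ _ (ltn_ord a) (ltn_ord b)) /=.
    by rewrite -!(tnth_nth _ (in_tuple s)) colinearE // => /negP.
  by case: (ltngtP l l') => [/no_lt/(_ ll')|/no_lt|/val_inj] //; rewrite eq_sym => /(_ ll').
have hit := mv_line_hit T_d rank_d Md0 zd0 d_lines.
split.
  rewrite -map_comp; apply/eq_in_map => x /s_d[l ->] /=.
  rewrite (mv_term_eq T_d rank_d d_lines).
  by apply: eq_bigl => j; rewrite inE.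
apply: uniq_perm; rewrite ?undup_uniq //.
  (* Distinct lines have distinct classes because, by [hit], no class is empty. *)
  rewrite uniq_pairwise pairwise_map; move: z_pair; rewrite pairwise_map.
  apply: sub_in_pairwise (allss s).
  move=> x y xs ys /=; rewrite colinearE ?z0 //.
  have [l ->] := s_d _ xs; have [j wj] := hit l.
  apply: contraNneq => /setP/(_ j); rewrite !inE wj => /esym /eqP <-.
  by rewrite eq_sym.
move=> C; rewrite mem_undup; apply/mapP/mapP => [[x /s_d[l ->] ->]|[j _ ->]].
  have [j wj] := hit l; exists j; first by rewrite mem_enum.
  by apply/setP => i; rewrite !inE (eqP wj).
have [l wj] := line_hit T_d rank_d j; exists (d l); first exact: mem_tnth.
by apply/setP => i; rewrite !inE (eqP wj).
Qed.

(** Terms with colinear [w i] are merged. The total rank is at most [r] by subadditivity and at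
    least [r] by [rank_lower_bound]. *)
Lemma mv_decomposition_exists : exists s, mv_decomposition T s /\ mv_rank s = r.
Proof.
(* [f] chooses a representative in each class of colinear [w_j]. *)
pose f j := odflt j [pick i | (<[w i]> == <[w j]>)%VS].
have f_line j : (<[w (f j)]> == <[w j]>)%VS.
  by rewrite /f; case: pickP => /=.
(* Both picks search the same predicate, which holds at [j], so the differing defaults are never
   reached. *)
have f_eq i j : (<[w i]> == <[w j]>)%VS -> f i = f j.
  move=> /eqP ij; rewrite /f ij; case: pickP => // /(_ j).
  by rewrite eqxx.
have f_id j : f (f j) = f j by exact/f_eq/f_line.
have [a w_a] : exists a : 'I_r -> K, forall i, w i = a i *: w (f i).
  apply: (@fin_all_exists 'I_r (fun=> K) (fun i c => w i = c *: w (f i))) => i.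
  by apply/vlineP; rewrite (eqP (f_line i)) memv_line.
pose M j := \sum_(i | f i == j) a i *: ((u i)^T *m v i).
pose s := [seq (M j, w j) | j <- enum [pred j | f j == j]].
have T_s : T = \sum_(t <- mv_terms s) t.
  rewrite /mv_terms !big_map big_enum /= /T.
  rewrite (partition_big f (fun j => f j == j)) => [|i _]; last by rewrite f_id.
  apply: eq_bigr => j _ /=; apply: slice_inj => k.
  rewrite slice_sum slice_mxvec /M linear_sum scaler_sumr.
  apply: eq_bigr => i /eqP <-.
  rewrite slice_pure linearZ /= trmx_mul trmxK scalerA mulrC.
  by have /rowP/(_ k) := w_a i; rewrite !mxE => ->.
have rank_s : mv_rank s = (\sum_(j | f j == j) \rank (M j))%N.
  by rewrite /mv_rank big_map big_enum.
(* The equality case is kept so that equality of the sums forces it for every [j]. *)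
have rank_le j : f j == j ->
    (\rank (M j) <= #|[pred i | f i == j]|
      ?= iff (\rank (M j) == #|[pred i | f i == j]|))%N.
  move=> _; apply: leqif_eq; rewrite -sum1_card.
  apply: (big_ind2 (fun (A : 'M[K]_(m, n)) q => \rank A <= q)%N) => [|A b B c Ab Bc|i _].
  - by rewrite mxrank0.
  - exact: leq_trans (mxrank_add _ _) (leq_add Ab Bc).
  - exact: leq_trans (mxrank_scale _ _) (mxrank_outer_le1 _ _).
have card_f : (\sum_(j | f j == j) #|[pred i | f i == j]| = r)%N.
  rewrite -[RHS](card_ord r) -sum1_card [RHS](partition_big f (fun j => f j == j)) => [|i _].
    by apply: eq_bigr => j _; rewrite -sum1_card.
  by rewrite f_id.
have r_le : (r <= mv_rank s)%N.
  rewrite /mv_rank (big_tnth _ _ s); apply: rank_lower_bound (fun l => (tnth (in_tuple s) l).2) _.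
  by rewrite T_s big_map (big_tnth _ _ s).
have [le_r] := leqif_sum rank_le; rewrite card_f -rank_s in le_r *.
rewrite eqn_leq le_r r_le => /esym/forall_inP rank_eq.
exists s; split; last by apply/eqP; rewrite eqn_leq le_r.
split=> //.
- apply/allP => _ /mapP[j + ->] /=; rewrite mem_enum inE => fj.
  (* The rank of [M j] is the size of the fibre of [f] over [j], which contains [j]. *)
  rewrite -mxrank_eq0 (eqP (rank_eq _ fj)) -lt0n.
  by apply/card_gt0P; exists j.
- by apply/allP => _ /mapP[j _ ->] /=.
- rewrite -map_comp pairwise_map.
  apply: (sub_in_pairwise (P := [pred j | f j == j]) (r := fun i j => i != j)).
  + move=> i j; rewrite !inE => /eqP fi /eqP fj /=.
    (* [f] is constant on lines and fixes both representatives. *)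
    by apply: contra; rewrite colinearE // => /f_eq; rewrite fi fj => ->.
  + by apply/allP => j; rewrite mem_enum.
  + by have := enum_uniq [pred j | f j == j]; rewrite uniq_pairwise.
Qed.

End Decompositions.

Theorem theorem1p3 (K : fieldType) (m n p r : nat) (T : tensor K m n p)
    (u : r.-tuple 'rV[K]_m) (v : r.-tuple 'rV[K]_n) (w : r.-tuple 'rV[K]_p)
    (hT : T = \sum_(i < r) pure_tensor (tnth u i) (tnth v i) (tnth w i))
    (hu : free u) (hv : free v) (hw : forall i : 'I_r, tnth w i != 0) :
  has_tensor_rank T r /\ unique_mv_decomposition T r.
Proof.
have fu := free_row_free hu; have fv := free_row_free hv.
split; split.
- exists (tnth u), (tnth v), (tnth w); split=> // i.
  by apply: pure_tensor_neq0; rewrite ?hw // (row_free_neq0 i fu, row_free_neq0 i fv).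
- move=> q [a [b [c [_ T_abc]]]].
  (* Each pure tensor is a matrix-vector term of matrix rank at most 1, so the lower bound gives
     [r <= q]. *)
  have T_Mz : \sum_i pure_tensor (tnth u i) (tnth v i) (tnth w i) =
      \sum_i mxvec_tensor ((a i)^T *m b i) (c i).
    by rewrite -hT T_abc; apply: eq_bigr => i _; rewrite pure_tensorE.
  apply: leq_trans (rank_lower_bound fu fv hw T_Mz) _.
  rewrite -[leqRHS](card_ord q) -sum1_card.
  by apply: leq_sum => i _; apply: mxrank_outer_le1.
- by rewrite hT; apply: mv_decomposition_exists.
- rewrite hT => s1 s2 dec1 rank1 dec2 rank2.
  have [-> perm1] := decomposition_classes fu fv hw dec1 rank1.
  have [-> perm2] := decomposition_classes fu fv hw dec2 rank2.
  by apply: perm_map; rewrite (permPl perm1) perm_sym.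
Qed.
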